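(* Let $\mathbf{k}$ be a field and let $\Gamma$ be a flag simplicial complex on $[n]$ such that $S/I_\Gamma$ has a pure resolution. Then one of the following holds: (1) $\Gamma$ is $1$-Leray; (2) $\Gamma$ is the join of a cycle and a simplex; (3) $\Gamma$ is the join of the boundary complex of a cross-polytope and a simplex. (Here the simplex factor may be empty.)
   Context: A simplicial complex on $[n]$ is a family of subsets closed under subsets containing all singletons. $\Gamma$ is flag if its Stanley–Reisner ideal $I_\Gamma\subset S=\mathbf{k}[x_1,\dots,x_n]$ (generated by monomials $\prod_{i\in F}x_i$, $F\notin\Gamma$) is generated in degree 2, i.e. every minimal non-face has two elements. With $M_i,m_i$ the maximal/minimal $j$ with $\beta_{i,j}(S/I_\Gamma)\neq0$ and $d-1=\dim\Gamma$, $S/I_\Gamma$ has a pure resolution if $m_i=M_i$ for $1\le i\le n-d$. $\Gamma$ is $t$-Leray if $\tilde H_p(\Gamma[W];\mathbf{k})=0$ for all $W\subseteq[n]$ and all $p\ge t$, where $\Gamma[W]$ is the induced subcomplex. The join $\Gamma_1*\Gamma_2$ has vertex set $V(\Gamma_1)\sqcup V(\Gamma_2)$ and faces $F$ with $F\cap V(\Gamma_i)\in\Gamma_i$. A cycle is the one-dimensional complex of vertices and edges of a polygon. The boundary complex of the $s$-dimensional cross-polytope has vertices $a_1,b_1,\dots,a_s,b_s$ and faces all sets containing no pair $\{a_i,b_i\}$. A simplex is the complex of all subsets of a finite set. *)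

(* Defs.v *)
From mathcomp Require Import all_boot all_order all_algebra.
Set Implicit Arguments. Unset Strict Implicit. Unset Printing Implicit Defensive.
Import GRing.Theory.
Local Open Scope ring_scope.

Definition complex (T : finType) := {set {set T}}.

Definition is_simplicial_complex (T : finType) (G : complex T) : Prop :=
  (forall F H : {set T}, F \in G -> H \subset F -> H \in G) /\
  (forall v : T, [set v] \in G).

Definition is_flag (T : finType) (G : complex T) : Prop :=
  forall F : {set T}, F \notin G ->
    (forall H : {set T}, H \proper F -> H \in G) -> #|F| = 2%N.

Definition bd_coef (k : fieldType) (T : finType) (F H : {set T}) : k :=
  if (H \subset F) && (#|F :\: H| == 1%N) then
    (-1) ^+ #|[set u in H | [exists t in F :\: H, (enum_rank u < enum_rank t)%N]]|
  else 0.

Definition cells (T : finType) (B : pred {set T}) (d : nat) : seq {set T} :=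
  [seq F <- enum [set: {set T}] | B F && (#|F| == d)].

Definition bdmx (k : fieldType) (T : finType) (B : pred {set T}) (d : nat) :
  'M[k]_(size (cells B d), size (cells B d.-1)) :=
  \matrix_(i, j) bd_coef k (nth set0 (cells B d) i) (nth set0 (cells B d.-1) j).

(* Dimension of the homology in cell-size d: dim ker d_d - dim im d_{d+1}. *)
Definition hdim (k : fieldType) (T : finType) (B : pred {set T}) (d : nat) : nat :=
  (size (cells B d) - \rank (bdmx k B d) - \rank (bdmx k B d.+1))%N.

(* Cells of the induced subcomplex G[W] (including the empty face, so that the
   homology is the reduced one); faces of dimension p have size p+1. *)
Definition induced_cells (T : finType) (G : complex T) (W : {set T}) : pred {set T} :=
  fun F => (F \in G) && (F \subset W).

Definition red_homology_dim (k : fieldType) (T : finType) (G : complex T)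
  (W : {set T}) (p : nat) : nat := hdim k (induced_cells G W) p.+1.

Definition is_Leray (k : fieldType) (t : nat) (T : finType) (G : complex T) : Prop :=
  forall (W : {set T}) (p : nat), (t <= p)%N -> red_homology_dim k G W p = 0%N.

(* ---------- graded Betti numbers of S/I_G via Koszul complexes ----------
   beta_{i,j}(S/I_G) = dim_k Tor_i^S(S/I_G, k)_j, computed as the homology of
   the Koszul complex K(x_1..x_n; S/I_G), split into multidegrees a in N^n with
   |a| = j.  In multidegree a, K_i has basis e_F (x) x^(a - e_F) for |F| = i,
   F subset supp a, and x^(a - e_F) nonzero in S/I_G, i.e. supp(a - e_F) in G.
   The differential is e_F (x) m |-> sum_{t in F} (-1)^pos e_{F\t} (x) x_t m. *)
Definition koszul_cells (n j : nat) (G : complex 'I_n) (a : {ffun 'I_n -> 'I_j.+1})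
  : pred {set 'I_n} :=
  fun F => (F \subset [set t | (0 < a t)%N]) &&
           ([set t | (0 < a t - (t \in F))%N] \in G).

Definition betti (k : fieldType) (n : nat) (G : complex 'I_n) (i j : nat) : nat :=
  (\sum_(a : {ffun 'I_n -> 'I_j.+1} | (\sum_(t < n) (a t : nat))%N == j)
     hdim k (koszul_cells G a) i)%N.

(* d - 1 = dim G, i.e. d = maximal size of a face. *)
Definition cx_d (n : nat) (G : complex 'I_n) : nat := (\max_(F in G) #|F|)%N.

Definition pure_resolution (k : fieldType) (n : nat) (G : complex 'I_n) : Prop :=
  forall i : nat, (1 <= i <= n - cx_d G)%N ->
    forall j j' : nat, betti k G i j <> 0%N -> betti k G i j' <> 0%N -> j = j'.

Definition simplex (T : finType) : complex T := [set: {set T}].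

Definition cycle_cx (m : nat) : complex 'I_m :=
  [set F : {set 'I_m} | (#|F| <= 1)%N || [exists i : 'I_m, F == [set i; ordS i]]].

(* Boundary of the s-dimensional cross-polytope: vertices a_i = (i,true),
   b_i = (i,false); faces are sets containing no pair {a_i, b_i}. *)
Definition cross_cx (s : nat) : complex ('I_s * bool)%type :=
  [set F : {set ('I_s * bool)%type} | [forall i : 'I_s, ~~ (((i, true) \in F) && ((i, false) \in F))]].

Definition join (T1 T2 : finType) (G1 : complex T1) (G2 : complex T2) : complex (T1 + T2)%type :=
  [set F : {set (T1 + T2)%type} | ([set x | inl x \in F] \in G1) && ([set y | inr y \in F] \in G2)].

Definition cx_iso (T1 T2 : finType) (G1 : complex T1) (G2 : complex T2) : Prop :=
  exists f : T1 -> T2, bijective f /\ forall F : {set T1}, (F \in G1) = (f @: F \in G2).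

(* Main.v *)
(* A flag complex is the clique complex of its 1-skeleton, so the argument is
   about a graph and its induced cycles of length at least 4. If there is none,
   then every non-complete induced subgraph has a clique separator, and gluing
   along simplices kills all homology in positive degrees: G is 1-Leray.
   By Hochster's formula an induced m-cycle gives beta_{m-2,m} <> 0, and m-2 is
   at most the codimension because a face meets the cycle in at most 2 vertices.
   By purity beta_{m-2,m-1} = 0, so no set of m-1 vertices has an isolated vertex.
   If m = 4, every vertex has at most one non-neighbour, and G is the join of a
   cross-polytope boundary and a simplex. If m >= 5 and there is no induced
   4-cycle, a vertex v off the cycle is adjacent to every vertex c on it (take v
   and the cycle minus the two neighbours of c), and two nonadjacent outside
   vertices would span an induced 4-cycle with two cycle vertices; so G is the
   join of the cycle and a simplex. *)
Require Import Defs.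
From mathcomp Require Import all_boot all_order all_algebra.
From mathcomp Require Import zify.

Set Implicit Arguments. Unset Strict Implicit. Unset Printing Implicit Defensive.
Import GRing.Theory.
Local Open Scope ring_scope.

(** * Induced cycles and clique separators *)

Definition adj (T : finType) (G : complex T) : rel T :=
  fun x y => (x != y) && ([set x; y] \in G).

Definition induced_cycle (T : finType) (e : rel T) (m : nat) (g : 'I_m -> T) : Prop :=
  injective g /\ forall i j, e (g i) (g j) = (j == ordS i) || (i == ordS j).

Lemma adj_sym (T : finType) (G : complex T) : symmetric (adj G).
Proof. by move=> x y; rewrite /adj eq_sym setUC. Qed.

(** A non-face contains a minimal one, which by flagness is a pair of vertices, hence a non-edge
    inside the given set. *)
Lemma flag_faceP (T : finType) (G : complex T) (F : {set T}) :
  is_simplicial_complex G -> is_flag G ->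
  reflect {in F &, forall x y, x != y -> adj G x y} (F \in G).
Proof.
move=> [Gdown Gvert] Gflag; apply: (iffP idP) => [FG x y xF yF xy|cliqueF].
  by rewrite /adj xy (Gdown F) // subUset !sub1set xF.
apply: contraT => FG.
have [H /minsetP[/= HG minH] HF] : {H | minset (fun H => H \notin G) H & H \subset F}.
  exact: minset_exists.
have /cards2P[x [y [xy HE]]] : #|H| == 2%N.
  apply/eqP/(Gflag) => // K KH; apply: contraT => KG.
  by have KE := minH K KG (proper_sub KH); rewrite KE properxx in KH.
have xF : x \in F by apply: (subsetP HF); rewrite HE !inE eqxx.
have yF : y \in F by apply: (subsetP HF); rewrite HE !inE eqxx orbT.
by have := cliqueF x y xF yF xy; rewrite /adj xy -HE (negbTE HG).
Qed.

Lemma shortest_path (T : finType) (e : rel T) (x y : T) :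
  connect e x y -> exists p, [/\ path e x p, last x p = y, uniq (x :: p)
    & forall i j, (i < j <= size p)%N ->
        e (nth x (x :: p) i) (nth x (x :: p) j) -> j = i.+1].
Proof.
move=> /connectP[p0 p0P p0y].
pose P n := [exists p : n.-tuple T, path e x p && (last x p == y)].
have exP : exists n, P n.
  by exists (size p0); apply/existsP; exists (in_tuple p0); rewrite /= p0P -p0y eqxx.
case: (ex_minnP exP) => n /existsP[p1 /andP[p1P /eqP p1y]] minn.
have {}minn p : path e x p -> last x p = y -> (n <= size p)%N.
  move=> pP py; apply: minn; apply/existsP; exists (in_tuple p).
  by rewrite /= pP py eqxx.
have : size p1 = n by rewrite size_tuple.
case: (shortenP p1P) p1y => p pP pU pp1 py szp1.
have szp : (size p <= n)%N by rewrite -szp1; apply: (uniq_leq_size _ pp1); case/andP: pU.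
exists p; split=> // i j /andP[ij jp] eij; apply/eqP; rewrite eqn_leq ij andbT.
rewrite leqNgt; apply/negP => ij1.
case: j => // j in jp ij ij1 eij *.
rewrite /= in eij.
have nthi : nth x (x :: p) i = last x (take i p).
  case: i {eij} ij ij1 => [|i] ij ij1 /=; first by rewrite take0.
  by rewrite -(nth_last x) size_takel ?nth_take //; lia.
have pd : drop j p = nth x p j :: drop j.+1 p by apply: drop_nth.
(* The edge from position [i] to position [j.+1] of [x :: p] skips what lies between; as [i < j],
   the new path is too short. *)
have : (n <= size (take i p ++ drop j p))%N.
  apply: minn; last by rewrite -py -{3}(cat_take_drop j p) !last_cat pd.
  have := pP; rewrite -{1}(cat_take_drop j p) !cat_path.
  have -> : path e x (take i p).
    by move: pP; rewrite -{1}(cat_take_drop i p) cat_path => /andP[].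
  by rewrite pd /= -nthi eij => /andP[_ /andP[_ ->]].
rewrite size_cat size_takel ?size_drop; last first.
  by apply: leq_trans (ltnW jp); rewrite -ltnS.
by move: (size p) jp szp => N jp szp; lia.
Qed.

Lemma ordS_val (m : nat) (i : 'I_m) :
  ordS i = (if i.+1 == m then 0 else i.+1)%N :> nat.
Proof.
rewrite /=; case: (eqVneq i.+1 m) => [->|im]; first by rewrite modnn.
by rewrite modn_small // ltn_neqAle im ltn_ord.
Qed.

Lemma eq_ordS (m : nat) (i j : 'I_m) :
  (j == ordS i) = (j == (if i.+1 == m then 0 else i.+1) :> nat)%N.
Proof. by rewrite -ordS_val. Qed.

(** The vertex [u] sees exactly the two ends of a chordless path. It takes position 0 and shifts the
    path by one, so the wrap-around edge joins the end of the path to [u]. *)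
Lemma cycle_of_path (T : finType) (e : rel T) (u x : T) (p : seq T) :
    symmetric e -> irreflexive e -> (2 <= size p)%N ->
    path e x p -> uniq [:: u, x & p] ->
    (forall i j, (i < j <= size p)%N ->
       e (nth x (x :: p) i) (nth x (x :: p) j) -> j = i.+1) ->
    (forall i, (i <= size p)%N ->
       e u (nth x (x :: p) i) = (i == 0%N) || (i == size p)) ->
  induced_cycle e (fun i : 'I_(size p).+2 => nth u [:: u, x & p] i).
Proof.
move=> esym eirr szp /pathP pP uniqp indp eu.
have eq0 b : (b <= size p)%N -> e u (nth u (x :: p) b) = (b == 0%N) || (b == size p).
  by move=> bp; rewrite (set_nth_default x) // eu.
have eq1 a b : (a < b <= size p)%N -> e (nth u (x :: p) a) (nth u (x :: p) b) = (b == a.+1).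
  move=> /andP[ab bp]; rewrite !(set_nth_default x u) //; last first.
    by rewrite /= ltnS; apply: leq_trans bp; apply: ltnW.
  apply/idP/eqP => [|bE]; first by apply: indp; rewrite ab.
  by move: bp; rewrite bE => bp; apply: pP.
have eq2 a b : (a < b < (size p).+2)%N ->
    e (nth u [:: u, x & p] a) (nth u [:: u, x & p] b) =
    (b == a.+1) || (a == 0%N) && (b == (size p).+1).
  move=> /andP[]; case: b => // b; case: a => [|a] ab bp.
    by rewrite /= -/(nth u (x :: p) b) eq0.
  by rewrite /= -/(nth u (x :: p) a) -/(nth u (x :: p) b) eq1 ?orbF //; apply/andP.
split.
  move=> i j eqn; apply/val_inj/eqP.
  by have := @nth_uniq _ u [:: u, x & p] i j (ltn_ord i) (ltn_ord j) uniqp; rewrite eqn eqxx => <-.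
move=> i j; rewrite !eq_ordS.
have := ltn_ord i; have := ltn_ord j.
move: (nat_of_ord i) (nat_of_ord j) => {i j} a b bp ap.
case: (ltngtP a b) => ab.
- rewrite eq2 ?ab //; move: (size p) szp ap bp => N szp ap bp; case: ifP; case: ifP; lia.
- rewrite esym eq2 ?ab //; move: (size p) szp ap bp => N szp ap bp; case: ifP; case: ifP; lia.
- rewrite ab eirr; move: (size p) szp ap bp => N szp ap bp; case: ifP; lia.
Qed.

(* Dirac's argument: if C is the component of v in W \ N[u], then its
   neighbourhood S lies in N(u), and a chordless path through C joining two
   nonadjacent elements of S closes up through u to an induced cycle. *)
Lemma clique_separator (T : finType) (e : rel T) (W : {set T}) (u v : T) :
    symmetric e -> irreflexive e ->
    (forall m (g : 'I_m -> T), (4 <= m)%N -> ~ induced_cycle e g) ->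
    u \in W -> v \in W -> u != v -> ~~ e u v ->
  exists A B : {set T}, [/\ A \proper W, B \proper W, A :|: B = W,
    {in A :&: B &, forall x y, x != y -> e x y} &
    forall x y, x \in A :\: B -> y \in B :\: A -> ~~ e x y].
Proof.
move=> esym eirr nocycle uW vW uv euv.
have [D inD] : exists D : {set T}, forall w, (w \in D) = [&& w \in W, w != u & ~~ e u w].
  by exists [set w in W | (w != u) && ~~ e u w] => w; rewrite !inE.
pose eD : rel T := fun a b => [&& a \in D, b \in D & e a b].
have [C inC] : exists C : {set T}, forall w, (w \in C) = connect eD v w.
  by exists [set w | connect eD v w] => w; rewrite inE.
have [S inS] : exists S : {set T}, forall w,
    (w \in S) = [&& w \in W, w \notin C & [exists c in C, e w c]].
  by exists [set w in W | (w \notin C) && [exists c in C, e w c]] => w; rewrite !inE.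
have vD : v \in D by rewrite inD vW eq_sym uv.
have CD w : w \in C -> w \in D.
  rewrite inC => /connectP[p pP ->]; elim: p (v) vD pP => //= a p IH b bD /andP[+ pP].
  by case/and3P => _ aD _; apply: IH.
have vC : v \in C by rewrite inC connect0.
have CW w : w \in C -> w \in W by move/CD; rewrite inD => /andP[].
have uC : u \notin C by apply/negP => /CD; rewrite inD eqxx andbF.
have eDsym : connect_sym eD.
  by apply: sym_connect_sym => a b; rewrite /eD esym; case: (a \in _); case: (b \in _).
have CS c w : c \in C -> w \in W -> e c w -> (w \in C) || (w \in S).
  move=> cC wW ecw; rewrite inS wW; case: (w \in C) => //=.
  by apply/existsP; exists c; rewrite cC esym.
(* A vertex of [S] not adjacent to [u] would lie in [D], and its edge to [C] would put it in [C]. It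
   is not [u] itself, because elements of [D] are not adjacent to [u]. *)
have SN s : s \in S -> (e u s) && (s \notin C).
  rewrite inS => /and3P[sW sC /existsP[c /andP[cC esc]]].
  have cD := CD _ cC; rewrite sC andbT; apply: contraR sC => us.
  have sD : s \in D.
    rewrite inD sW us andbT /=; apply/eqP => su.
    by move: cD; rewrite inD -su esc !andbF.
  move: cC; rewrite !inC => /connect_trans; apply.
  by apply: connect1; rewrite /eD cD sD esym.
(* The pieces overlap exactly in [S]; the first misses [u] and the second misses [v], so both are
   proper. *)
exists (C :|: S), (W :\: C).
have capE w : (w \in (C :|: S) :&: (W :\: C)) = (w \in S).
  by rewrite !inE inS; case: (w \in C); case: (w \in W); rewrite ?andbF ?andbT.
have CSW w : w \in C :|: S -> w \in W.
  by rewrite inE => /orP[/CW//|]; rewrite inS => /andP[].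
split.
- rewrite properE; apply/andP; split; first by apply/subsetP.
  apply/negP => /subsetP/(_ u uW); rewrite inE (negbTE uC) /=.
  by move=> /SN; rewrite eirr.
- rewrite properE subsetDl /=.
  by apply/negP => /subsetP/(_ v vW); rewrite inE vC.
- apply/setP => w; apply/setUP/idP => [[/CSW|/setDP[]]//|wW].
  by rewrite !inE wW; case: (w \in C); [left|right].
- move=> x y; rewrite !capE => xS yS xy; apply: contraT => exy.
  have /andP[ux xC] := SN _ xS; have /andP[uy yC] := SN _ yS.
  (* Restricting to [x], [y] and [C] forces the interior of the path into [C], hence away from the
     neighbours of [u]. *)
  pose e' : rel T := fun a b => [&& a \in x |: (y |: C), b \in x |: (y |: C) & e a b].
  have e'sym : connect_sym e'.
    by apply: sym_connect_sym => a b; rewrite /e' esym; case: (a \in _); case: (b \in _).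
  have nbr s : s \in S -> s \in x |: (y |: C) -> connect e' v s.
    rewrite inS => /and3P[_ _ /existsP[c /andP[cC esc]]] sC'.
    apply: (@connect_trans _ _ c); last first.
      by apply: connect1; rewrite /e' sC' !in_setU cC !orbT /= esym.
    move: cC; rewrite inC => /connectP[p pP ->].
    apply/connectP; exists p => //.
    elim: p (v) vC pP => //= a p IH b bC /andP[eba pP].
    have aC : a \in C.
      by move: bC; rewrite !inC => /connect_trans; apply; apply: connect1.
    rewrite IH // andbT /e' !in_setU aC bC !orbT /=.
    by case/and3P: eba.
  have /shortest_path[p [pP py pU pind]] : connect e' x y.
    apply: (@connect_trans _ _ v); last by apply: nbr; rewrite // !inE eqxx orbT.
    by rewrite e'sym; apply: nbr; rewrite // !inE eqxx.
  have pC' i : (i <= size p)%N -> nth x (x :: p) i \in x |: (y |: C).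
    case: i => [|i] ip; first by rewrite !inE eqxx.
    by have /(pathP x)/(_ i ip)/and3P[] := pP.
  have nthy : nth x (x :: p) (size p) = y by rewrite -py (last_nth x).
  have szp : (2 <= size p)%N.
    case: p {pU pind pC' nthy} py pP => [/eqP|a [|b p]] //=.
      by rewrite (negbTE xy).
    by move=> -> /andP[/and3P[_ _]]; rewrite (negbTE exy).
  exfalso; apply: (nocycle (size p).+2 (fun i => nth u [:: u, x & p] i)) => //.
  have midC i : (i <= size p)%N -> i != 0%N -> i != size p -> nth x (x :: p) i \in C.
    move=> ip i0 iy; have := pC' i ip; rewrite 2!in_setU 2!in_set1.
    have -> : (nth x (x :: p) i == x) = false.
      by have := @nth_uniq _ x (x :: p) i 0 ip isT pU; rewrite (negbTE i0).
    have -> : (nth x (x :: p) i == y) = false.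
      by rewrite -nthy; have := @nth_uniq _ x (x :: p) i (size p) ip (leqnn _) pU; rewrite (negbTE iy).
    by [].
  apply: cycle_of_path => //.
  + by apply: sub_path pP => a b /and3P[].
  + rewrite cons_uniq pU andbT; apply/(nthP x) => -[i]; rewrite /= ltnS => ip iE.
    have [i0|i0] := eqVneq i 0%N; first by move: ux; rewrite -iE i0 /= eirr.
    have [iy|iy] := eqVneq i (size p); first by move: uy; rewrite -iE iy nthy eirr.
    by have := midC i ip i0 iy; rewrite iE (negbTE uC).
  + move=> i j /andP[ij jp] eij; apply: pind; rewrite ?ij // /e' eij !pC' //.
    by apply: leq_trans jp; apply: ltnW.
  + move=> i ip; have [->|i0] := eqVneq i 0%N; first by rewrite ux.
    have [->|iy] := eqVneq i (size p); first by rewrite nthy uy orbT.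
    by have := CD _ (midC i ip i0 iy); rewrite inD => /and3P[_ _ /negbTE].
- move=> x y /setDP[xA xB] /setDP[/setDP[yW yC] yA].
  have xC : x \in C by apply: contraR xB => xC; rewrite inE xC CSW.
  by apply: contra yA => exy; rewrite inE (CS x).
Qed.

(** * Simplicial chains *)

Definition bd_sign (k : fieldType) (T : finType) (F : {set T}) (t : T) : k :=
  (-1) ^+ #|[set u in F | (enum_rank u < enum_rank t)%N]|.

Lemma bd_sign_neq0 (k : fieldType) (T : finType) (F : {set T}) (t : T) :
  bd_sign k F t != 0.
Proof. by rewrite signr_eq0. Qed.

Lemma bd_coefD1 (k : fieldType) (T : finType) (F : {set T}) (t : T) :
  t \in F -> bd_coef k F (F :\ t) = bd_sign k F t.
Proof.
move=> tF; have FtE : F :\: (F :\ t) = [set t].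
  by apply/setP => u; rewrite !inE; case: eqP => [->|_]; rewrite ?tF //= andNb.
rewrite /bd_coef subD1set FtE cards1 /=; congr (_ ^+ _); apply: eq_card => u.
rewrite !inE; have -> : [exists t0 in [set t], (enum_rank u < enum_rank t0)%N]
    = (enum_rank u < enum_rank t)%N.
  apply/existsP/idP => [[w]|ut]; last by exists t; rewrite inE eqxx.
  by rewrite inE => /andP[/eqP->].
by case: eqP => [->|] //=; rewrite ltnn andbF.
Qed.

Lemma bd_coef_neq0 (k : fieldType) (T : finType) (F H : {set T}) :
  bd_coef k F H != 0 -> exists2 t, t \in F & H = F :\ t.
Proof.
rewrite /bd_coef; case: ifP; last by rewrite eqxx.
move=> /andP[HF /cards1P[t tE]] _.
have : t \in F :\: H by rewrite tE inE.
rewrite inE => /andP[tH tF]; exists t => //.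
by rewrite -tE setDDr setDv set0U; apply/esym/setIidPr.
Qed.

Lemma bd_signD1 (k : fieldType) (T : finType) (F : {set T}) (t v : T) :
  v \in F -> v != t ->
  bd_sign k (F :\ v) t = (-1) ^+ (enum_rank v < enum_rank t)%N * bd_sign k F t.
Proof.
move=> vF vt; rewrite /bd_sign (cardsD1 v [set u in F | _]) !inE vF /= exprD mulrA.
rewrite -expr2 sqrr_sign mul1r; congr (_ ^+ _); apply: eq_card => u.
by rewrite !inE andbA.
Qed.

(** Deleting [v] flips the sign of [t] exactly when [v] precedes [t]. One of the two precedes the
    other, so the two orders of deletion differ by one sign. *)
Lemma bd_coef_anti (k : fieldType) (T : finType) (F : {set T}) (t v : T) :
  t \in F -> v \in F -> v != t ->
  bd_coef k F (F :\ v) * bd_coef k (F :\ v) (F :\ v :\ t) =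
  - (bd_coef k F (F :\ t) * bd_coef k (F :\ t) (F :\ t :\ v)).
Proof.
move=> tF vF vt.
rewrite !bd_coefD1 // ?inE ?vt ?tF ?vF //=; last by rewrite eq_sym vt.
rewrite !bd_signD1 // 1?eq_sym //.
have : enum_rank v != enum_rank t by rewrite (inj_eq enum_rank_inj).
rewrite neq_ltn => /orP[] lt; rewrite lt ltnNge (ltnW lt) /= expr0 expr1 ?mul1r mulN1r.
  by rewrite mulrN mulrC.
by rewrite mulrN mulrC opprK.
Qed.

(** Unless [H] is [v |: F] minus a vertex of [F], both sides vanish; otherwise this is the
    anticommutation of the deletions of [v] and of that vertex. It supplies the signs for the cone
    over a cycle. *)
Lemma cone_sign (k : fieldType) (T : finType) (F H : {set T}) (v : T) :
  v \notin F -> v \in H ->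
  bd_sign k (v |: F) v * bd_coef k (v |: F) H = - (bd_coef k F (H :\ v) * bd_sign k H v).
Proof.
move=> vF vH; case: (boolP [exists t in F, H == (v |: F) :\ t]); last first.
  move=> /existsPn nt; rewrite [bd_coef k (v |: F) H](_ : _ = 0); last first.
    apply/eqP; apply: contraT => /bd_coef_neq0[t]; rewrite !inE => /orP[/eqP->|tF] HE.
      by move: vH; rewrite HE !inE eqxx.
    by have := nt t; rewrite tF HE eqxx.
  rewrite [bd_coef k F _](_ : _ = 0) ?mul0r ?oppr0 ?mulr0 //.
  apply/eqP; apply: contraT => /bd_coef_neq0[t tF HE].
  have := nt t; rewrite tF /= -(setD1K vH) HE setDUl.
  have -> : [set v] :\ t = [set v].
    by apply/setDidPl; rewrite disjoints1 inE; apply: contraNneq vF => ->.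
  by rewrite eqxx.
move=> /existsP[t /andP[tF /eqP HE]].
have tv : t != v by apply: contraNneq vF => <-.
have tvF : t \in v |: F by rewrite !inE tF orbT.
have := @bd_coef_anti k T (v |: F) t v tvF (setU11 _ _); rewrite eq_sym tv => /(_ isT).
rewrite setU1K // -HE bd_coefD1 // -{2}(setU1K vF) (bd_coefD1 _ (setU11 _ _)).
have HvE : H :\ v = F :\ t.
  apply/setP => w; rewrite HE !inE.
  by case: (eqVneq w v) => //= ->; rewrite (negbTE vF) andbF.
rewrite HvE (bd_coefD1 k tF) -HvE bd_coefD1 // => anti.
have sq (A : {set T}) w : bd_sign k A w * bd_sign k A w = 1 by rewrite -expr2 sqrr_sign.
have -> : bd_coef k (v |: F) H = - (bd_sign k (v |: F) v * bd_sign k F t) * bd_sign k H v.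
  by rewrite anti opprK -mulrA sq mulr1.
by rewrite mulrA mulrN mulrA sq mul1r mulNr.
Qed.

(** A nonzero term comes from deleting two vertices of [F] in succession; the only other term that
    can be nonzero deletes them in the opposite order and cancels it. *)
Lemma bd_bd (k : fieldType) (T : finType) (F K : {set T}) :
  \sum_(H : {set T}) bd_coef k F H * bd_coef k H K = 0.
Proof.
case: (pickP (fun H => bd_coef k F H * bd_coef k H K != 0)) => [H|z]; last first.
  by apply: big1 => H _; apply/eqP; have /negbFE := z H.
rewrite mulf_eq0 negb_or => /andP[/bd_coef_neq0[v vF ->] /bd_coef_neq0[t]].
rewrite !inE => /andP[tv tF] ->.
have vt : v != t by rewrite eq_sym.
rewrite (bigD1 (F :\ v)) //= (bigD1 (F :\ t)) /=; last first.
  by apply/negP => /eqP/setP/(_ v); rewrite !inE eqxx vF vt.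
rewrite addrA (bd_coef_anti k tF vF vt) [F :\ v :\ t]setDDl setUC -setDDl.
rewrite addNr add0r; apply: big1 => H' /andP[Hv Ht]; apply/eqP.
apply: contraT; rewrite mulf_eq0 negb_or.
move=> /andP[/bd_coef_neq0[w wF HE] /bd_coef_neq0[z zH]].
move=> /setP/(_ w); rewrite HE !inE eqxx wF !andbF andbT => /negbT.
rewrite negb_and !negbK => /orP[]/eqP wE.
  by rewrite HE wE eqxx in Hv.
by rewrite HE wE eqxx in Ht.
Qed.

(** Chains are functions on all sets, with supports controlled by [chain_on]; matrix indices enter
    only in the comparison with [hdim]. *)
Definition bd (k : fieldType) (T : finType) (c : {set T} -> k) : {set T} -> k :=
  fun H => \sum_F c F * bd_coef k F H.

Lemma bdD (k : fieldType) (T : finType) (c c' : {set T} -> k) (H : {set T}) :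
  bd (fun F => c F + c' F) H = bd c H + bd c' H.
Proof. by rewrite /bd -big_split /=; apply: eq_bigr => F _; rewrite mulrDl. Qed.

Lemma bdB (k : fieldType) (T : finType) (c c' : {set T} -> k) (H : {set T}) :
  bd (fun F => c F - c' F) H = bd c H - bd c' H.
Proof. by rewrite /bd -sumrB; apply: eq_bigr => F _; rewrite mulrBl. Qed.

Lemma bd_bd0 (k : fieldType) (T : finType) (c : {set T} -> k) (K : {set T}) :
  bd (bd c) K = 0.
Proof.
rewrite /bd; under eq_bigr do rewrite mulr_suml.
rewrite exchange_big /=; apply: big1 => F _.
by under eq_bigr do rewrite -mulrA; rewrite -mulr_sumr bd_bd mulr0.
Qed.

(** Degrees count vertices: [d] is the dimension plus one, as in [hdim]. *)
Definition chain_on (k : fieldType) (T : finType) (G : complex T) (W : {set T}) (d : nat)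
    (c : {set T} -> k) : Prop :=
  forall F, c F != 0 -> induced_cells G W F /\ #|F| = d.

Definition acyclic (k : fieldType) (T : finType) (G : complex T) (W : {set T}) (d : nat) : Prop :=
  forall c : {set T} -> k, chain_on G W d c -> (forall H, bd c H = 0) ->
    exists2 e, chain_on G W d.+1 e & forall H, bd e H = c H.

Lemma chain_onD (k : fieldType) (T : finType) (G : complex T) (W W1 W2 : {set T}) (d : nat)
    (c c' : {set T} -> k) :
  W1 \subset W -> W2 \subset W -> chain_on G W1 d c -> chain_on G W2 d c' ->
  chain_on G W d (fun F => c F + c' F).
Proof.
move=> s1 s2 hc hc' F; have [z|/hc[/andP[FG FW] Fd] _] := eqVneq (c F) 0.
  rewrite z add0r => /hc'[/andP[FG FW] Fd].
  by rewrite /induced_cells FG (subset_trans FW).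
by rewrite /induced_cells FG (subset_trans FW).
Qed.

Lemma chain_onN (k : fieldType) (T : finType) (G : complex T) (W : {set T}) (d : nat)
    (c : {set T} -> k) : chain_on G W d c -> chain_on G W d (fun F => - c F).
Proof. by move=> hc F; rewrite oppr_eq0 => /hc. Qed.

Lemma chain_on_bd (k : fieldType) (T : finType) (G : complex T) (W : {set T}) (d : nat)
    (c : {set T} -> k) :
  is_simplicial_complex G -> chain_on G W d.+1 c -> chain_on G W d (bd c).
Proof.
move=> [Gdown _] hc H; case: (pickP (fun F => c F * bd_coef k F H != 0)) => [F|z]; last first.
  by rewrite /bd big1 ?eqxx // => F _; apply/eqP; have /negbFE := z F.
rewrite mulf_eq0 negb_or => /andP[/hc[/andP[FG FW] Fd] /bd_coef_neq0[t tF ->]] _.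
rewrite /induced_cells (Gdown F) ?subD1set // (subset_trans _ FW) ?subD1set //.
by split=> //; move: Fd; rewrite (cardsD1 t) tF => -[].
Qed.

(* The cone from the vertex v contracts the simplex on W. *)
Lemma acyclic_clique (k : fieldType) (T : finType) (G : complex T) (W : {set T}) (d : nat) :
  is_simplicial_complex G -> W \in G -> (0 < d)%N -> acyclic k G W d.
Proof.
move=> [Gdown Gvert] WG d0 c hc cycle.
case: (set_0Vmem W) => [W0|[v vW]].
  have c0 F : c F = 0.
    apply/eqP; apply: contraT => /hc[/andP[_ +] Fd].
    by rewrite W0 subset0 -cards_eq0 Fd => /eqP d00; rewrite d00 in d0.
  by exists (fun=> 0) => [F|H]; rewrite ?eqxx // c0 /bd big1 // => F _; rewrite mul0r.
(* The cone over the cells of [c] that avoid [v], signed so that deleting [v] gives [c] back. *)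
exists (fun F : {set T} => if v \in F then c (F :\ v) * bd_sign k F v else 0) => [F|H].
  case: ifP => [vF|_]; last by rewrite eqxx.
  rewrite mulf_eq0 negb_or => /andP[/hc[/andP[_ FW] Fd] _].
  have FW' : F \subset W by rewrite -(setD1K vF) subUset sub1set vW.
  by rewrite /induced_cells (Gdown W) // FW' (cardsD1 v) vF Fd.
rewrite /bd; have [vH|vH] := boolP (v \in H); last first.
  rewrite (bigD1 (v |: H)) //= setU11 setU1K //.
  have -> : bd_coef k (v |: H) H = bd_sign k (v |: H) v.
    by rewrite -{2}(setU1K vH) bd_coefD1 ?setU11.
  rewrite -mulrA -expr2 sqrr_sign mulr1.
  rewrite big1 ?addr0 // => F FvH; apply/eqP; apply: contraT.
  case: ifP => [vF|]; last by rewrite mul0r eqxx.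
  rewrite mulf_eq0 negb_or => /andP[_ /bd_coef_neq0[t tF HE]].
  move: vH FvH; rewrite HE !inE vF andbT negbK => /eqP ->.
  by rewrite setD1K ?eqxx.
(* When [v] lies in [H], the cycle condition at [H :\ v] expresses [c H] through cells avoiding [v];
   these match the cone cells [v |: F] by [cone_sign]. *)
have := cycle (H :\ v); rewrite /bd (bigD1 H) //= bd_coefD1 // => /eqP.
rewrite addr_eq0 => /eqP cH.
have -> : c H = - (\sum_(i | i != H) c i * bd_coef k i (H :\ v)) * bd_sign k H v.
  by rewrite -cH -mulrA -expr2 sqrr_sign mulr1.
rewrite -sumrN mulr_suml [RHS](bigID (fun F : {set T} => v \in F)) /=.
rewrite [X in X + _]big1 ?add0r; last first.
  move=> F /andP[FH vF]; rewrite [_ * bd_coef _ _ _](_ : _ = 0) ?oppr0 ?mul0r //.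
  apply/eqP; apply: contraT; rewrite mulf_eq0 negb_or => /andP[_ /bd_coef_neq0[t tF HE]].
  have tv : t = v.
    by apply/eqP; move/setP: HE => /(_ v); rewrite !inE eqxx vF andbT /= => /esym/negbFE; rewrite eq_sym.
  by move: FH; rewrite -(setD1K vF) -(setD1K vH) HE tv eqxx.
rewrite [LHS](bigID (fun F : {set T} => v \in F)) /= [X in _ + X]big1 ?addr0; last first.
  by move=> F /negbTE ->; rewrite mul0r.
rewrite (reindex_onto (fun F : {set T} => v |: F) (fun F => F :\ v)) /=; last first.
  by move=> F vF; rewrite setD1K.
rewrite (eq_bigl (fun F : {set T} => v \notin F)); last first.
  move=> F; rewrite setU11 /=; apply/eqP/idP => [<-|/setU1K //].
  by rewrite !inE eqxx.
apply: eq_big => F; first by case: eqVneq => [->|]; rewrite ?vH ?andbF.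
move=> vF; rewrite setU11 setU1K // -mulrA cone_sign //.
by rewrite mulrN mulNr mulrA.
Qed.

(** * Gluing along a simplex *)

(* Mayer-Vietoris, by hand *)
Lemma acyclic_glue (k : fieldType) (T : finType) (G : complex T) (W A B : {set T}) (d : nat) :
    is_simplicial_complex G -> A :|: B = W ->
    (forall F, F \in G -> F \subset W -> F \subset A \/ F \subset B) ->
    acyclic k G A d.+1 -> acyclic k G B d.+1 -> acyclic k G (A :&: B) d ->
  acyclic k G W d.+1.
Proof.
move=> Gsc ABW split_face acA acB acAB c hc cyc.
(* Cut [c] into the part inside [A] and the rest, which lies in [B]. Their boundaries are opposite,
   so they live in [A :&: B] and are filled there by [w]; correcting by [w] makes both parts
   cycles. *)
pose cA (F : {set T}) := if F \subset A then c F else 0.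
pose cB (F : {set T}) := c F - cA F.
have hA : chain_on G A d.+1 cA.
  move=> F; rewrite /cA; case: ifP => [FA /hc[/andP[FG _] Fd]|]; last by rewrite eqxx.
  by rewrite /induced_cells FG.
have hB : chain_on G B d.+1 cB.
  move=> F; rewrite /cB /cA; case: ifP => [|FA]; first by rewrite subrr eqxx.
  rewrite subr0 => /hc[/andP[FG FW] Fd]; rewrite /induced_cells FG.
  by case: (split_face F FG FW); rewrite ?FA.
have bdAB H : bd cB H = - bd cA H by rewrite bdB cyc sub0r.
have [w hw bdw] : exists2 w, chain_on G (A :&: B) d.+1 w & forall H, bd w H = bd cA H.
  apply: acAB; last exact: bd_bd0.
  move=> H nz; have [/andP[HG HA] Hd] := chain_on_bd Gsc hA nz.
  have [/andP[_ HB] _] : induced_cells G B H /\ #|H| = d.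
    by apply: (chain_on_bd Gsc hB); rewrite bdAB oppr_eq0.
  by rewrite /induced_cells HG subsetI HA.
have [||eA heA bdeA] := acA (fun F => cA F - w F).
- apply: chain_onD (chain_onN hw) => //; exact: subsetIl.
- by move=> H; rewrite bdB bdw subrr.
have [||eB heB bdeB] := acB (fun F => cB F + w F).
- apply: chain_onD hw => //; exact: subsetIr.
- by move=> H; rewrite bdD bdw bdAB addNr.
exists (fun F => eA F + eB F).
  by apply: chain_onD heA heB; rewrite -ABW ?subsetUl ?subsetUr.
by move=> H; rewrite bdD bdeA bdeB addrACA addNr addr0 /cB addrC subrK.
Qed.

(** * From fillings of cycles to matrix ranks; the chordal case *)

Lemma mem_cells (T : finType) (B : pred {set T}) (d : nat) (F : {set T}) :
  (F \in cells B d) = B F && (#|F| == d).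
Proof. by rewrite mem_filter mem_enum inE andbT. Qed.

Lemma cells_uniq (T : finType) (B : pred {set T}) (d : nat) : uniq (cells B d).
Proof. exact/filter_uniq/enum_uniq. Qed.

(** Matrix products sum over positions in [cells], [bd] over all sets; the support condition
    reconciles the two. *)
Lemma sum_cells (k : fieldType) (T : finType) (B : pred {set T}) (d : nat) (f : {set T} -> k) :
  (forall F, f F != 0 -> B F /\ #|F| = d) ->
  \sum_(i < size (cells B d)) f (nth set0 (cells B d) i) = \sum_F f F.
Proof.
move=> hf; rewrite (bigID (fun F => F \in cells B d)) /= [X in _ + X]big1 ?addr0.
  rewrite -big_uniq ?cells_uniq //= (big_nth set0) big_mkord.
  by [].
move=> F; rewrite mem_cells => nF; apply/eqP; apply: contraT => /hf[BF /eqP Fd].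
by rewrite BF Fd in nF.
Qed.

(** Row vectors killed by the boundary matrix are cycles. Filling each one puts the kernel inside
    the row space of the next matrix, and the resulting rank inequality makes the truncated
    difference in [hdim] zero. *)
Lemma hdim_acyclic (k : fieldType) (T : finType) (G : complex T) (W : {set T}) (d : nat) :
  is_simplicial_complex G -> (0 < d)%N -> acyclic k G W d -> hdim k (induced_cells G W) d = 0%N.
Proof.
move=> [Gdown _] d0 ac; rewrite /hdim.
set B := induced_cells G W.
suff : (kermx (bdmx k B d) <= bdmx k B d.+1)%MS.
  move=> /mxrankS; rewrite mxrank_ker => h.
  by apply/eqP; rewrite subn_eq0.
apply/row_subP => i; set u := row i _.
have : u *m bdmx k B d = 0 by apply/sub_kermxP/row_sub.
move: u => {i} u uA.
pose s := cells B d.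
pose c F := \sum_(i < size s | nth set0 s i == F) u 0 i.
have cnth (i : 'I_(size s)) : c (nth set0 s i) = u 0 i.
  rewrite /c (big_pred1 i) // => j.
  by rewrite nth_uniq ?cells_uniq.
have hc : chain_on G W d c.
  move=> F nz; have [i /eqP <-|none] := pickP (fun i : 'I_(size s) => nth set0 s i == F); last first.
    by rewrite /c big_pred0 ?eqxx in nz.
  by have := mem_nth set0 (ltn_ord i); rewrite mem_cells => /andP[? /eqP ?]; split.
have [H|e he bde] := ac c hc.
  have -> : bd c H = \sum_(i < size s) u 0 i * bd_coef k (nth set0 s i) H.
    rewrite /bd -(@sum_cells k T B d); first by apply: eq_bigr => i _; rewrite cnth.
    by move=> F; rewrite mulf_eq0 negb_or => /andP[/hc].
  have [Hs|Hs] := boolP (H \in cells B d.-1).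
    have Hi : (index H (cells B d.-1) < size (cells B d.-1))%N by rewrite index_mem.
    move/rowP: uA => /(_ (Ordinal Hi)); rewrite !mxE => uH.
    by rewrite -[RHS]uH; apply: eq_bigr => i _; rewrite mxE /= nth_index.
  apply: big1 => i _; apply/eqP; apply: contraT.
  rewrite mulf_eq0 negb_or => /andP[_ /bd_coef_neq0[t tF HE]].
  case/negP: Hs; have := mem_nth set0 (ltn_ord i); rewrite !mem_cells HE.
  move=> /andP[/andP[FG FW] /eqP <-]; rewrite /B /induced_cells (Gdown _ _ FG) ?subD1set //.
  by rewrite (subset_trans (subD1set _ _) FW) (cardsD1 t (nth set0 s i)) tF eqxx.
apply/submxP; exists (\row_i e (nth set0 (cells B d.+1) i)).
apply/rowP => j; rewrite mxE -cnth -bde /bd -(@sum_cells k T B d.+1).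
  by apply: eq_bigr => i _; rewrite !mxE.
by move=> F; rewrite mulf_eq0 negb_or => /andP[/he].
Qed.

(** Induction on the size of [W]: a non-face [W] has two nonadjacent vertices, hence a clique
    separator. No edge crosses it, so every face lies in one of the two pieces. *)
Lemma chordal_Leray (k : fieldType) (T : finType) (G : complex T) :
  is_simplicial_complex G -> is_flag G ->
  (forall m (g : 'I_m -> T), (4 <= m)%N -> ~ induced_cycle (adj G) g) ->
  is_Leray k 1 G.
Proof.
move=> Gsc Gflag nocycle W p p1; apply: hdim_acyclic => //.
(* The cell size is now [p.+2], so gluing needs the separator to be acyclic in size [p.+1]. A
   simplex, even an empty one, is so because this size is positive. *)
case: p p1 => // p _; have [n] := ubnP #|W|; elim: n W => // n IH W Wn.
have [WG|] := boolP (W \in G); first exact: acyclic_clique.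
have [|] := boolP [exists u in W, [exists v in W, (u != v) && ~~ adj G u v]]; last first.
  move=> /exists_inPn noW /(flag_faceP _ Gsc Gflag)[] x y xW yW xy.
  by have /exists_inPn/(_ y yW) := noW x xW; rewrite xy negbK.
move=> /exists_inP[u uW /exists_inP[v vW /andP[uv euv]]] _.
have irr : irreflexive (adj G) by move=> x; rewrite /adj eqxx.
have [A [B [AW BW ABW clAB sepAB]]] :=
  clique_separator (@adj_sym T G) irr nocycle uW vW uv euv.
apply: (acyclic_glue Gsc ABW).
- move=> F FG FW; have [FA|/subsetPn[x xF xA]] := boolP (F \subset A); first by left.
  right; apply/subsetP => y yF; apply: contraT => yB.
  have xB : x \in B by move/subsetP: FW => /(_ x xF); rewrite -ABW inE (negbTE xA).
  have yA : y \in A by move/subsetP: FW => /(_ y yF); rewrite -ABW inE (negbTE yB) orbF.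
  have /negP[] : ~~ adj G y x by apply: sepAB; rewrite !inE ?yA ?yB ?xA ?xB.
  move/(flag_faceP _ Gsc Gflag): FG; apply=> //.
  by apply: contraNneq yB => ->.
- by apply: IH; have := proper_card AW; lia.
- by apply: IH; have := proper_card BW; lia.
by apply: acyclic_clique => //; apply/(flag_faceP _ Gsc Gflag).
Qed.

(** * Nonvanishing Betti numbers *)

(** Koszul cells need not be closed under subsets, so closure under intermediate sets is assumed
    instead: every set between two cells then occurs in the matrices, and [bd_bd] applies. *)
Lemma bdmx_bdmx (k : fieldType) (T : finType) (B : pred {set T}) (d : nat) :
  (forall F H K : {set T}, B F -> B K -> K \subset H -> H \subset F -> B H) ->
  bdmx k B d.+1 *m bdmx k B d = 0.
Proof.
move=> Bconv; apply/matrixP => i j; rewrite !mxE /=.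
set F := nth set0 (cells B d.+1) i; set K := nth set0 (cells B d.-1) j.
have := mem_nth set0 (ltn_ord i); rewrite -/F mem_cells => /andP[BF /eqP Fd].
have := mem_nth set0 (ltn_ord j); rewrite -/K mem_cells => /andP[BK _].
rewrite -[RHS](bd_bd k F K) -(@sum_cells k T B d).
  by apply: eq_bigr => l _; rewrite !mxE.
move=> H; rewrite mulf_eq0 negb_or => /andP[/bd_coef_neq0[t tF HE] /bd_coef_neq0[z zH KE]].
split; last by move: Fd; rewrite HE (cardsD1 t F) tF => -[].
by apply: (Bconv F H K) => //; rewrite ?KE ?HE subD1set.
Qed.

(* In the squarefree multidegree W, the Koszul cells are the complements in W
   of the faces of G[W]. *)
Lemma betti_neq0 (k : fieldType) (n : nat) (G : complex 'I_n) (W : {set 'I_n}) (i : nat) :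
  (0 < #|W|)%N ->
  (forall B : pred {set 'I_n}, (forall F, B F = (F \subset W) && (W :\: F \in G)) ->
     hdim k B i <> 0%N) ->
  betti k G i #|W| <> 0%N.
Proof.
move=> W0 hW; set j := #|W|.
(* The indicator function of [W]; [betti] is a sum of naturals, so its summand at [a] suffices. *)
pose a : {ffun 'I_n -> 'I_j.+1} := [ffun t => inord (t \in W)].
have aE t : a t = (t \in W) :> nat.
  by rewrite ffunE inordK //; case: (t \in W).
have aj : (\sum_(t < n) (a t : nat))%N == j.
  have -> : (\sum_(t < n) a t = \sum_(t < n) (t \in W))%N by apply: eq_bigr => t _.
  by rewrite -[in X in X == _](big_mkcond (mem W) (fun=> 1%N)) sum1_card.
rewrite /betti (bigD1 a) //= => /eqP; rewrite addn_eq0 => /andP[/eqP h _].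
apply: hW h => F; rewrite /koszul_cells.
have -> : [set t | (0 < a t)%N] = W by apply/setP => t; rewrite inE aE lt0b.
have -> // : [set t | (0 < a t - (t \in F))%N] = W :\: F.
by apply/setP => t; rewrite !inE aE; case: (t \in W); case: (t \in F).
Qed.

Lemma koszul_convex (T : finType) (G : complex T) (W : {set T}) (B : pred {set T}) :
  is_simplicial_complex G -> (forall F, B F = (F \subset W) && (W :\: F \in G)) ->
  forall F H K : {set T}, B F -> B K -> K \subset H -> H \subset F -> B H.
Proof.
move=> [Gdown _] BE F H K; rewrite !BE => /andP[FW _] /andP[_ KG] KH HF.
by rewrite (subset_trans HF FW) (Gdown _ _ KG) // setDS.
Qed.

(** The cell [W :\ v], dual to the face [[set v]], is a cycle because no edge at [v] stays in [W].
    It is no boundary: a boundary is a multiple of the signed sum of all [W :\ x], and some [x]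
    differs from [v]. *)
Lemma hdim_isolated (k : fieldType) (T : finType) (G : complex T) (W : {set T})
    (B : pred {set T}) (v : T) :
  is_simplicial_complex G -> (forall F, B F = (F \subset W) && (W :\: F \in G)) ->
  v \in W -> (1 < #|W|)%N -> {in W, forall x, ~~ adj G v x} ->
  hdim k B #|W|.-1 <> 0%N.
Proof.
move=> Gsc BE vW W1 viso; have [Gdown Gvert] := Gsc; rewrite /hdim.
have Wp : #|W|.-1.+1 = #|W| by rewrite prednK // ltnW.
set d := #|W|.-1 in Wp *.
have cellsD1 x : x \in W -> W :\ x \in cells B d.
  move=> xW; rewrite mem_cells BE subD1set /= /d (cardsD1 x W) xW eqxx andbT.
  by apply: (Gdown [set x]) => //; rewrite setDDr setDv set0U subsetIr.
pose z : 'rV[k]_(size (cells B d)) := \row_i (nth set0 (cells B d) i == W :\ v)%:R.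
have zker : (z <= kermx (bdmx k B d))%MS.
  apply/sub_kermxP/rowP => j; rewrite !mxE; apply: big1 => i _; rewrite !mxE.
  case: eqP => [->|]; last by rewrite mul0r.
  rewrite mul1r; apply/eqP; apply: contraT => /bd_coef_neq0[t]; rewrite !inE => /andP[tv tW] HE.
  have := mem_nth set0 (ltn_ord j); rewrite mem_cells HE BE => /andP[/andP[_ H] _].
  case/negP: (viso t tW); rewrite /adj eq_sym tv; congr (_ \in G): H.
  apply/setP => x; rewrite !inE; case: (eqVneq x t) => [->|_]; first by rewrite tW orbT.
  by case: eqVneq => [->|_] /=; rewrite ?vW // andNb.
have znotin : ~~ (z <= bdmx k B d.+1)%MS.
  apply/negP => /submxP[D zE].
  (* All cells of size [#|W|] equal [W], so the combination [D] reduces to the scalar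
     [\sum_i D 0 i]. *)
  have zD x : x \in W -> (W :\ x == W :\ v)%:R = (\sum_i D 0 i) * bd_sign k W x.
    move=> xW; have ix : (index (W :\ x) (cells B d) < size (cells B d))%N.
      by rewrite index_mem cellsD1.
    move/rowP: zE => /(_ (Ordinal ix)); rewrite !mxE /= nth_index ?cellsD1 // => ->.
    rewrite mulr_suml; apply: eq_bigr => i _; rewrite mxE /= nth_index ?cellsD1 //.
    congr (_ * _); rewrite -bd_coefD1 //; congr (bd_coef _ _ _); apply/eqP.
    have := mem_nth set0 (ltn_ord i); rewrite mem_cells BE => /andP[/andP[iW _] /eqP id].
    by rewrite eqEcard iW id Wp leqnn.
  have [x xW xv] : exists2 x, x \in W & x != v.
    case/card_gt1P: W1 => x [y [xW yW xy]].
    case: (eqVneq x v) => [xv|]; last by exists x.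
    by exists y => //; rewrite -xv eq_sym.
  have := zD x xW; rewrite (_ : (W :\ x == W :\ v) = false); last first.
    by apply/eqP => /setP/(_ v); rewrite !inE eqxx vW eq_sym xv.
  move=> /esym/eqP; rewrite mulf_eq0 (negbTE (bd_sign_neq0 _ _ _)) orbF => /eqP D0.
  by have /eqP := zD v vW; rewrite eqxx D0 mul0r oner_eq0.
have : (bdmx k B d.+1 < kermx (bdmx k B d))%MS.
  apply/andP; split; last by apply: contra znotin => /(submx_trans zker).
  by apply/sub_kermxP/bdmx_bdmx/(koszul_convex Gsc BE).
by move=> /rank_ltmx; rewrite mxrank_ker; lia.
Qed.

Lemma cycle_triangle_free (m : nat) (i j l : 'I_m) : (4 <= m)%N ->
  (j == ordS i) || (i == ordS j) -> (l == ordS j) || (j == ordS l) ->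
  (l == ordS i) || (i == ordS l) -> False.
Proof.
rewrite !eq_ordS; have := ltn_ord i; have := ltn_ord j; have := ltn_ord l.
move: (nat_of_ord i) (nat_of_ord j) (nat_of_ord l) => a b c.
by case: ifP; case: ifP; case: ifP; lia.
Qed.

Lemma ordS_edge_inj (m : nat) (i j : 'I_m) : (3 <= m)%N ->
  [set i; ordS i] = [set j; ordS j] -> i = j.
Proof.
move=> m3 /setP ij; apply/val_inj => /=; move: (ij i) (ij j).
rewrite !inE !eqxx /= !eq_ordS -!val_eqE /=; have := ltn_ord i; have := ltn_ord j.
move: (nat_of_ord i) (nat_of_ord j) => a b.
case: ifP; case: ifP; lia.
Qed.

(** Three vertices of a face are pairwise adjacent, and a cycle of length at least 4 has no
    triangle. *)
Lemma cycle_face_card (T : finType) (G : complex T) (m : nat) (g : 'I_m -> T) (F : {set T}) :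
    is_simplicial_complex G -> is_flag G -> (4 <= m)%N -> induced_cycle (adj G) g ->
    F \in G -> F \subset g @: setT -> (#|F| <= 2)%N.
Proof.
move=> Gsc Gflag m4 [ginj gadj] /(flag_faceP _ Gsc Gflag) cl /subsetP Fg.
rewrite leqNgt; apply/negP => /card_gt2P[x [y [z [[xF yF zF] [xy yz zx]]]]].
have /imsetP[i _ xE] := Fg x xF; have /imsetP[j _ yE] := Fg y yF.
have /imsetP[l _ zE] := Fg z zF; subst.
apply: (@cycle_triangle_free m i j l m4); rewrite -gadj; apply: cl => //.
by rewrite eq_sym.
Qed.

(** A count of ranks. Passing to complements, size [m - 2] has at least [m] cells (edges) and size
    [m - 1] at most [m] (vertices), while size [m - 3] has none. The map from size [m] is nonzero,
    so the one from size [m - 1] has rank at most [m - 1], and some homology survives. *)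
Lemma hdim_cycle (k : fieldType) (T : finType) (G : complex T) (m : nat) (g : 'I_m -> T)
    (B : pred {set T}) :
  is_simplicial_complex G -> is_flag G -> (4 <= m)%N -> induced_cycle (adj G) g ->
  (forall F, B F = (F \subset g @: setT) && (g @: setT :\: F \in G)) ->
  hdim k B (m - 2) <> 0%N.
Proof.
move=> Gsc Gflag m4 gcyc BE; have [Gdown Gvert] := Gsc; have [ginj gadj] := gcyc.
set W := g @: setT in BE *.
have Wm : #|W| = m by rewrite card_imset // cardsT card_ord.
have [q qE] : exists q, m = q.+4 by exists (m - 4)%N; lia.
have -> : (m - 2 = q.+2)%N by lia.
rewrite /hdim.
have cells_small : size (cells B q.+1) = 0%N.
  apply/eqP; rewrite size_eq0; apply: contraT.
  case sE : (cells B q.+1) => [//|F s] _; have : F \in cells B q.+1 by rewrite sE mem_head.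
  rewrite mem_cells BE => /andP[/andP[FW FG] /eqP Fq].
  have := cycle_face_card Gsc Gflag m4 gcyc FG (subsetDl _ _).
  by rewrite cardsDS // Fq Wm; lia.
have -> : \rank (bdmx k B q.+2) = 0%N.
  by apply/eqP; rewrite -leqn0 -[X in (_ <= X)%N]cells_small rank_leq_col.
have cells_edges : (m <= size (cells B q.+2))%N.
  pose s := [seq W :\: [set g i; g (ordS i)] | i <- enum 'I_m].
  have sm : size s = m by rewrite size_map size_enum_ord.
  have eW i : [set g i; g (ordS i)] \subset W by rewrite subUset !sub1set !imset_f.
  rewrite -[X in (X <= _)%N]sm; apply: uniq_leq_size.
    rewrite map_inj_uniq ?enum_uniq // => i j eij; apply: ordS_edge_inj; first by lia.
    apply: (imset_inj ginj); rewrite !imsetU1 !imset_set1.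
    have WK (A : {set T}) : A \subset W -> W :\: (W :\: A) = A.
      by move=> /setIidPr AW; rewrite setDDr setDv set0U.
    by rewrite -(WK _ (eW i)) -(WK _ (eW j)) eij.
  move=> F /mapP[i _ ->]; rewrite mem_cells BE subsetDl setDDr setDv set0U.
  rewrite (setIidPr (eW i)) cardsDS // Wm cards2.
  have : adj G (g i) (g (ordS i)) by rewrite gadj eqxx.
  by rewrite /adj => /andP[-> ->] /=; apply/eqP; lia.
have cells_vertices : (size (cells B q.+3) <= m)%N.
  pose s := [seq W :\ x | x <- enum W].
  have sm : size s = m by rewrite size_map -cardE.
  rewrite -[X in (_ <= X)%N]sm; apply: uniq_leq_size; first exact: cells_uniq.
  move=> F; rewrite mem_cells BE => /andP[/andP[FW FG] /eqP Fq].
  have /cards1P[x xE] : #|W :\: F| == 1%N by rewrite cardsDS // Fq Wm qE; lia.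
  apply/mapP; exists x; first by rewrite mem_enum; have /setDP[] : x \in W :\: F by rewrite xE inE.
  by rewrite -xE setDDr setDv set0U (setIidPr FW).
have := mulmx0_rank_max (bdmx_bdmx k q.+3 (koszul_convex Gsc BE)).
have arith (r4 r3 s3 s2 : nat) :
  (s3 <= m)%N -> (m <= s2)%N -> r4 != 0%N -> (r4 + r3 <= s3)%N -> (s2 - 0 - r3)%N <> 0%N by lia.
apply: arith => //.
rewrite mxrank_eq0; apply/negP => /eqP/matrixP.
  pose x := g (cast_ord (esym qE) ord0).
  have xW : x \in W by apply: imset_f.
  have Wc : W \in cells B q.+4.
    by rewrite mem_cells BE subxx setDv Wm qE eqxx andbT (Gdown [set x]) ?sub0set.
  have Wxc : W :\ x \in cells B q.+3.
    rewrite mem_cells BE subD1set setDDr setDv set0U (setIidPr _) ?sub1set // Gvert.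
    by move: Wm; rewrite (cardsD1 x) xW /= => Wm; apply/eqP; lia.
  have Wi : (index W (cells B q.+4) < size (cells B q.+4))%N by rewrite index_mem.
  have Wxi : (index (W :\ x) (cells B q.+3) < size (cells B q.+3))%N by rewrite index_mem.
  move=> /(_ (Ordinal Wi) (Ordinal Wxi)); rewrite !mxE /= !nth_index // bd_coefD1 //.
  by apply/eqP; rewrite bd_sign_neq0.
Qed.

(** * Join decompositions *)

(** The vertex maps below run from the join to [G], and faces are tested on preimages; the bijection
    in the other direction is obtained by choice. *)
Lemma cx_iso_pullback (T1 T2 : finType) (G1 : complex T1) (G2 : complex T2) (h : T2 -> T1) :
  injective h -> (forall y, exists x, h x == y) ->
  (forall F : {set T1}, (F \in G1) = ([set x | h x \in F] \in G2)) -> cx_iso G1 G2.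
Proof.
move=> hinj hsurj hG; pose f y := xchoose (hsurj y).
have fK : cancel f h by move=> y; apply/eqP/(xchooseP (hsurj y)).
have hK : cancel h f by move=> x; apply: hinj; rewrite fK.
exists f; split=> [|F]; first by exists h.
rewrite hG; congr (_ \in G2); apply/setP => x; rewrite inE.
apply/idP/imsetP => [hx|[y yF ->]]; last by rewrite fK.
by exists (h x); rewrite ?hK.
Qed.

Lemma mem_join_simplex (T1 T2 T : finType) (G : complex T1) (h : T1 + T2 -> T) (F : {set T}) :
  ([set x | h x \in F] \in join G (simplex T2)) = ([set x | h (inl x) \in F] \in G).
Proof.
rewrite !inE andbT; congr (_ \in G); apply/setP => x; by rewrite !inE.
Qed.

(** The vertices off the cycle span the simplex factor. Being adjacent to everything, they impose no
    condition on a face, so only its trace on the cycle matters. *)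
Lemma cycle_join_iso (T : finType) (G : complex T) (m : nat) (g : 'I_m -> T) :
    is_simplicial_complex G -> is_flag G -> (4 <= m)%N -> induced_cycle (adj G) g ->
    (forall v w, v \notin g @: setT -> v != w -> adj G v w) ->
  exists r, cx_iso G (join (cycle_cx m) (simplex 'I_r)).
Proof.
move=> Gsc Gflag m4 gcyc univ; have [Gdown Gvert] := Gsc; have [ginj gadj] := gcyc.
exists #|~: (g @: setT)|.
pose h (x : 'I_m + 'I_#|~: (g @: setT)|) :=
  match x with inl i => g i | inr j => enum_val j end.
have hr (j : 'I_#|~: (g @: setT)|) : enum_val j \notin g @: setT.
  by have := enum_valP j; rewrite inE.
have gC i : g i \in g @: setT by apply: imset_f.
apply: (@cx_iso_pullback _ _ _ _ h).
- move=> [i|j] [i'|j'] /=; first by move/ginj->.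
  + by move=> E; have := hr j'; rewrite -E gC.
  + by move=> E; have := hr j; rewrite E gC.
  by move/enum_val_inj->.
- move=> y; have [/imsetP[i _ ->]|yC] := boolP (y \in g @: setT).
    by exists (inl i).
  have yC' : y \in ~: (g @: setT) by rewrite inE.
  by exists (inr (enum_rank_in yC' y)); rewrite /= enum_rankK_in.
move=> F; rewrite mem_join_simplex /= inE; set F' := [set i | g i \in F].
apply/idP/idP => [FG|F'E].
  have [//|F'1] := leqP #|F'| 1; apply/existsP.
  have F'2 : (#|F'| <= 2)%N.
    rewrite -(card_imset _ ginj); apply: (cycle_face_card Gsc Gflag m4 gcyc); last first.
      exact/imsetS/subsetT.
    by apply: (Gdown F) => //; apply/subsetP => _ /imsetP[i + ->]; rewrite inE.
  have /cards2P[i [j [ij F'E]]] : #|F'| == 2%N by rewrite eqn_leq F'2.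
  have : adj G (g i) (g j).
    have inF l : l \in [set i; j] -> g l \in F by rewrite -F'E inE.
    move/(flag_faceP _ Gsc Gflag): FG; apply; rewrite ?inF ?inE ?eqxx ?orbT //.
    by rewrite (inj_eq ginj).
  rewrite gadj => /orP[]/eqP E; first by exists i; rewrite F'E E.
  by exists j; rewrite F'E E setUC.
apply/(flag_faceP _ Gsc Gflag) => x y xF yF xy.
have [/imsetP[i _ xE]|xC] := boolP (x \in g @: setT); last exact: univ.
have [/imsetP[j _ yE]|yC] := boolP (y \in g @: setT); last first.
  by rewrite adj_sym univ // eq_sym.
have ij : i != j by apply: contraNneq xy => ij; rewrite xE yE ij.
have iF' : i \in F' by rewrite inE -xE.
have jF' : j \in F' by rewrite inE -yE.
rewrite xE yE gadj; case/orP: F'E => [|/existsP[l /eqP F'E]].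
  move=> /card_le1_eqP/(_ i j iF' jF') E; by rewrite E eqxx in ij.
move: iF' jF' ij; rewrite F'E !inE => /orP[]/eqP-> /orP[]/eqP->; rewrite ?eqxx ?orbT //.
Qed.

(** Each vertex has at most one non-neighbour, so non-adjacency is an involution. Its two-element
    orbits are the antipodal pairs of the cross-polytope; its fixed points span the simplex. *)
Lemma cross_join_iso (T : finType) (G : complex T) (a b : T) :
    is_simplicial_complex G -> is_flag G -> a != b -> ~~ adj G a b ->
    (forall x y z, x != y -> x != z -> ~~ adj G x y -> ~~ adj G x z -> y = z) ->
  exists s r, (1 <= s)%N /\ cx_iso G (join (cross_cx s) (simplex 'I_r)).
Proof.
move=> Gsc Gflag ab nab uniq_opp.
(* The default [v] makes vertices adjacent to all others the fixed points. *)
pose opp v := odflt v [pick w | (v != w) && ~~ adj G v w].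
have oppE v w : v != w -> ~~ adj G v w -> opp v = w.
  move=> vw nvw; rewrite /opp; case: pickP => [w' /andP[vw' nvw']|/(_ w)] /=.
    exact: uniq_opp nvw' nvw.
  by rewrite vw nvw.
have nadj_opp v : ~~ adj G v (opp v).
  by rewrite /opp; case: pickP => [w' /andP[]|_] //=; rewrite /adj eqxx.
have oppK v : opp (opp v) = v.
  have [vE|vN] := eqVneq v (opp v); first by rewrite -!vE.
  by apply: oppE; rewrite 1?eq_sym // adj_sym.
have adjE x y : x != y -> y != opp x -> adj G x y.
  by move=> xy; apply: contraR => nxy; rewrite (oppE x y).
(* [P] takes from each antipodal pair the vertex enumerated first. *)
pose P := [set v | (enum_rank v < enum_rank (opp v))%N].
pose Q := [set v | opp v == v].
have PQ v : v \in P -> opp v \notin P /\ v \notin Q /\ opp v \notin Q.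
  rewrite !inE oppK => vP; split; first by rewrite -leqNgt ltnW.
  by split; apply: contraTneq vP => E; [rewrite E ltnn|rewrite -E ltnn].
have cover v : [|| v \in P, opp v \in P | v \in Q].
  by rewrite !inE oppK; case: ltngtP => //= /val_inj/enum_rank_inj <-.
exists #|P|, #|Q|; split.
  apply/card_gt0P; have := cover a.
  have -> : (a \in Q) = false by rewrite inE (oppE a b) // eq_sym (negbTE ab).
  by case: (boolP (a \in P)) => [|_] aP; [exists a|exists (opp a)]; rewrite // orbF in aP.
pose h (x : 'I_#|P| * bool + 'I_#|Q|) : T :=
  match x with
  | inl (i, true) => enum_val i | inl (i, false) => opp (enum_val i)
  | inr j => enum_val j
  end.
have Pi (i : 'I_#|P|) : enum_val i \in P := enum_valP i.
have Qj (j : 'I_#|Q|) : enum_val j \in Q := enum_valP j.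
apply: (@cx_iso_pullback _ _ _ _ h).
- move=> [[i []]|j] [[i' []]|j'] /= E.
  + by rewrite (enum_val_inj E).
  + by have [] := PQ _ (Pi i'); rewrite -E Pi.
  + by have [_ []] := PQ _ (Pi i); rewrite E Qj.
  + by have [] := PQ _ (Pi i); rewrite E Pi.
  + by rewrite (enum_val_inj (can_inj oppK E)).
  + by have [_ [_]] := PQ _ (Pi i); rewrite E Qj.
  + by have [_ []] := PQ _ (Pi i'); rewrite -E Qj.
  + by have [_ [_]] := PQ _ (Pi i'); rewrite -E Qj.
  by rewrite (enum_val_inj E).
- move=> y; case/or3P: (cover y) => yP.
  + by exists (inl (enum_rank_in yP y, true)); rewrite /= enum_rankK_in.
  + by exists (inl (enum_rank_in yP (opp y), false)); rewrite /= enum_rankK_in ?oppK.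
  by exists (inr (enum_rank_in yP y)); rewrite /= enum_rankK_in.
move=> F; rewrite mem_join_simplex inE; apply/idP/forallP => [FG i|Fi].
  rewrite !inE /=; apply/negP => /andP[xF yF].
  have := nadj_opp (enum_val i); move/(flag_faceP _ Gsc Gflag): FG => -> //.
  by have := Pi i; rewrite inE; apply: contraTneq => <-; rewrite ltnn.
have noP x : x \in P -> x \in F -> opp x \in F -> False.
  move=> xP xF yF; have := Fi (enum_rank_in xP x).
  by rewrite !inE /= enum_rankK_in // xF yF.
apply/(flag_faceP _ Gsc Gflag) => x y xF yF xy; apply: adjE => //.
apply/eqP => yE; rewrite yE in yF; case/or3P: (cover x) => xP.
- exact: noP xP xF yF.
- by apply: (noP _ xP yF); rewrite oppK.
by move: xP; rewrite inE -yE eq_sym (negbTE xy).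
Qed.

(** * Purity and the case distinction *)

Definition has_induced_cycle (T : finType) (e : rel T) (m : nat) : bool :=
  [exists g : {ffun 'I_m -> T}, injectiveb g &&
     [forall i, forall j, e (g i) (g j) == (j == ordS i) || (i == ordS j)]].

Lemma has_induced_cycleP (T : finType) (e : rel T) (m : nat) :
  reflect (exists g : 'I_m -> T, induced_cycle e g) (has_induced_cycle e m).
Proof.
apply: (iffP existsP) => [[g /andP[/injectiveP ginj /forallP ge]]|[g [ginj ge]]].
  by exists g; split=> // i j; have /forallP/(_ j)/eqP := ge i.
exists (finfun g); apply/andP; split.
  by apply/injectiveP => i j; rewrite !ffunE => /ginj.
by apply/forallP => i; apply/forallP => j; rewrite !ffunE ge.
Qed.

Lemma induced_C4 (T : finType) (e : rel T) (a b c d : T) :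
    symmetric e -> irreflexive e -> a != c -> b != d ->
    e a b -> e b c -> e c d -> e d a -> ~~ e a c -> ~~ e b d ->
  induced_cycle e (fun i : 'I_4 => nth a [:: a; b; c; d] i).
Proof.
move=> esym eirr ac bd eab ebc ecd eda nac nbd.
have neq x y : e x y -> x != y by apply: contraTneq => ->; rewrite eirr.
have U : uniq [:: a; b; c; d].
  by rewrite /= !inE !negb_or ac bd (neq _ _ eab) (neq _ _ ebc) (neq _ _ ecd) eq_sym (neq _ _ eda).
split=> [i j eqn|i j].
  apply/val_inj/eqP.
  by have := @nth_uniq _ a [:: a; b; c; d] i j (ltn_ord i) (ltn_ord j) U; rewrite eqn eqxx => <-.
rewrite !eq_ordS; have sy x y : e x y -> e y x by rewrite esym.
have nsy x y : ~~ e x y -> ~~ e y x by rewrite esym.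
by case: i j => [[|[|[|[|//]]]] /= _] [[|[|[|[|//]]]] /= _];
  rewrite ?eirr ?eab ?ebc ?ecd ?eda ?(negbTE nac) ?(negbTE nbd) ?(sy _ _ eab) ?(sy _ _ ebc)
     ?(sy _ _ ecd) ?(sy _ _ eda) ?(negbTE (nsy _ _ nac)) ?(negbTE (nsy _ _ nbd)).
Qed.

(** A largest face contains at most two vertices of the cycle, so at least [m - 2] lie outside it.
    This puts the homological degree [m - 2] in the range where purity is assumed. *)
Lemma cycle_codim (n : nat) (G : complex 'I_n) (m : nat) (g : 'I_m -> 'I_n) :
  is_simplicial_complex G -> is_flag G -> (4 <= m)%N -> induced_cycle (adj G) g ->
  (m - 2 <= n - cx_d G)%N.
Proof.
move=> Gsc Gflag m4 gcyc; have [Gdown Gvert] := Gsc; have [ginj _] := gcyc.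
have i0 : 'I_m by exists 0%N; lia.
have [F FG ->] : exists2 F : {set 'I_n}, F \in G & cx_d G = #|F|.
  have [|F FG FE] := @eq_bigmax_cond _ (mem G) (fun F : {set 'I_n} => #|F|); last by exists F.
  by apply/card_gt0P; exists [set g i0]; apply: Gvert.
set W := g @: setT.
have Wm : #|W| = m by rewrite card_imset // cardsT card_ord.
have WF2 : (#|W :&: F| <= 2)%N.
  apply: (cycle_face_card Gsc Gflag m4 gcyc); last exact: subsetIl.
  by apply: (Gdown F) => //; apply: subsetIr.
have arith (a b c d : nat) :
  (a + b = m -> d + c = n -> b <= c -> a <= 2 -> m - 2 <= n - d)%N by lia.
apply: (arith #|W :&: F| #|W :\: F| #|~: F|) => //; first by rewrite cardsID.
  by rewrite cardsC card_ord.
by apply/subset_leq_card/subsetP => x; rewrite !inE => /andP[].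
Qed.

(** In homological degree [m - 2], which is also [#|W|.-1], the cycle gives a nonzero Betti number
    of internal degree [m] and [W] one of internal degree [m.-1]. *)
Lemma pure_no_isolated (k : fieldType) (n : nat) (G : complex 'I_n) (m : nat) (g : 'I_m -> 'I_n)
    (W : {set 'I_n}) (v : 'I_n) :
  is_simplicial_complex G -> is_flag G -> pure_resolution k G ->
  (4 <= m)%N -> induced_cycle (adj G) g -> #|W| = m.-1 -> v \in W ->
  ~ {in W, forall x, ~~ adj G v x}.
Proof.
move=> Gsc Gflag pure m4 gcyc Wm vW viso; have [ginj _] := gcyc.
have Cm : #|g @: setT| = m by rewrite card_imset // cardsT card_ord.
have codim : (1 <= m - 2 <= n - cx_d G)%N.
  by rewrite (cycle_codim Gsc Gflag m4 gcyc); lia.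
have betti_C : betti k G (m - 2) m <> 0%N.
  rewrite -[X in betti _ _ _ X]Cm; apply: betti_neq0; first by rewrite Cm; lia.
  by move=> B BE; apply: hdim_cycle gcyc BE.
have betti_W : betti k G (m - 2) m.-1 <> 0%N.
  rewrite -[X in betti _ _ _ X]Wm; apply: betti_neq0; first by rewrite Wm; lia.
  move=> B BE; have -> : (m - 2)%N = #|W|.-1 by rewrite Wm; lia.
  by apply: hdim_isolated BE vW _ viso => //; rewrite Wm; lia.
by have := pure _ codim _ _ betti_C betti_W; lia.
Qed.

Theorem theorem6p1 (k : fieldType) (n : nat) (G : {set {set 'I_n}}) :
  is_simplicial_complex G -> is_flag G -> pure_resolution k G ->
  [\/ is_Leray k 1 G,
      exists m r : nat, (3 <= m)%N /\ cx_iso G (join (cycle_cx m) (simplex 'I_r))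
    | exists s r : nat, (1 <= s)%N /\ cx_iso G (join (cross_cx s) (simplex 'I_r))].
Proof.
move=> Gsc Gflag pure.
have adjirr : irreflexive (adj G) by move=> x; rewrite /adj eqxx.
have adjsym : symmetric (adj G) by apply: adj_sym.
have [/has_induced_cycleP[g gcyc]|noC4] := boolP (has_induced_cycle (adj G) 4).
  apply: Or33; have [ginj gadj] := gcyc.
  have m4 : (4 <= 4)%N by [].
  apply: (@cross_join_iso _ _ (g ord0) (g (ordS (ordS ord0)))) => //.
  - by rewrite (inj_eq ginj).
  - by rewrite gadj.
  move=> x y z xy xz nxy nxz; apply: contraTeq isT => yz.
  (* Two distinct non-neighbours of [x] would make it isolated in a set of 3 vertices. *)
  exfalso; apply: (@pure_no_isolated k n G 4 g (x |: [set y; z]) x) => //.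
  - by rewrite cardsU1 cards2 !inE negb_or xy xz yz.
  - by rewrite !inE eqxx.
  by move=> w; rewrite !inE => /or3P[]/eqP->; rewrite ?adjirr.
(* By injectivity an induced cycle has at most [n] vertices, so lengths range over ['I_n.+1] and the
   case split is decidable. *)
have [/existsP[m' /andP[]]|nocycle] :=
  boolP [exists m : 'I_n.+1, (4 <= m)%N && has_induced_cycle (adj G) m]; last first.
  apply: Or31; apply: chordal_Leray => // m g m4 gcyc; case/negP: nocycle.
  have mn : (m < n.+1)%N by have := leq_card g (proj1 gcyc); rewrite !card_ord.
  apply/existsP; exists (Ordinal mn); rewrite /= m4.
  by apply/has_induced_cycleP; exists g.
move: (nat_of_ord m') => {m'} m m4 /has_induced_cycleP[g gcyc].
have [ginj gadj] := gcyc; set C := g @: setT.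
have m5 : (5 <= m)%N.
  rewrite ltn_neqAle m4 andbT; apply: contraNneq noC4 => mE; rewrite mE.
  by apply/has_induced_cycleP; exists g.
have Cm : #|C| = m by rewrite card_imset // cardsT card_ord.
have outC v i : v \notin C -> adj G v (g i).
  move=> vC; apply: contraT => nvi; exfalso.
  (* [N] consists of the neighbours of [g i] on the cycle. Replacing them by [v] leaves [m - 1]
     vertices among which [g i] is isolated. *)
  pose N := [set g (ordS i); g (ord_pred i)].
  have NC : N \subset C by rewrite subUset !sub1set !imset_f.
  have cN : #|N| = 2%N.
    rewrite cards2 (inj_eq ginj); apply/eqP; rewrite eqSS eqb1.
    apply: contraTneq isT => /(congr1 (@ordS m)); rewrite ord_predK => E.
    by have := eqxx i; rewrite -{2}E eq_ordS ordS_val; have := ltn_ord i; do 2!case: ifP; lia.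
  apply: (@pure_no_isolated k n G m g (v |: (C :\: N)) (g i)) => //.
  - by rewrite cardsU1 !inE (negbTE vC) andbF cardsDS // Cm cN /=; lia.
  - rewrite 3!inE imset_f // andbT !inE !(inj_eq ginj) negb_or.
    have iS : i != ordS i.
      by rewrite eq_ordS; have := ltn_ord i; case: ifP; lia.
    rewrite iS; apply/orP; right; apply: contraNneq iS => E.
    by rewrite {2}E ord_predK.
  move=> w; rewrite !inE => /orP[/eqP->|/andP[]]; first by rewrite adjsym.
  move=> + /imsetP[j _ wE]; rewrite wE !(inj_eq ginj) gadj negb_or => /andP[ji jp].
  rewrite (negbTE ji) /=; apply: contra jp => /eqP->; by rewrite ordSK.
apply: Or32; exists m.
have [|r iso] := cycle_join_iso Gsc Gflag m4 gcyc; last by exists r; split=> //; lia.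
move=> v w vC vw; have [/imsetP[i _ ->]|wC] := boolP (w \in C); first exact: outC.
apply: contraNT noC4 => nvw; apply/has_induced_cycleP.
have i0 : 'I_m by exists 0%N; lia.
(* Two cycle vertices at distance 2 are nonadjacent since [m] is at least 5, and both are adjacent
   to [v] and [w] by [outC]. *)
eexists; apply: (@induced_C4 _ _ v (g i0) w (g (ordS (ordS i0)))) => //.
- by rewrite (inj_eq ginj) eq_ordS ordS_val; have := ltn_ord i0; do 2!case: ifP; lia.
- exact: outC.
- by rewrite adjsym outC.
- exact: outC.
- by rewrite adjsym outC.
by rewrite gadj !eq_ordS !ordS_val; have := ltn_ord i0; do !case: ifP; lia.
Qed.
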